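(* Let $(\mathcal{H},T)$ be a Hilbert module such that $T$ is normal. Then $T$ is unitary if and only if $$\operatorname{Ext}^1_{A(\mathbb{D})}(T,T)=0.$$
   Context: $\mathbb{D}$ is the open unit disc in $\mathbb{C}$ and $A(\mathbb{D})$ is the disc algebra (functions holomorphic on $\mathbb{D}$ and continuous on $\overline{\mathbb{D}}$). A bounded linear operator $T$ on a Hilbert space $\mathcal{H}$ is polynomially bounded if there is a constant $C>0$ with $\|p(T)\|\le C\sup_{|z|<1}|p(z)|$ for every polynomial $p$; in that case $(\mathcal{H},T)$ (or simply $T$) is called a Hilbert module (over $A(\mathbb{D})$, via $f\cdot h=f(T)h$). For Hilbert modules $(\mathcal{H}_1,T_1)$ and $(\mathcal{H}_2,T_2)$, the extension group $\operatorname{Ext}^1_{A(\mathbb{D})}(T_2,T_1)$ is identified with the quotient $\mathcal{A}/\mathcal{J}$, where $\mathcal{A}$ is the space of bounded operators $X:\mathcal{H}_2\to\mathcal{H}_1$ for which $\begin{pmatrix}T_1&X\\0&T_2\end{pmatrix}$ on $\mathcal{H}_1\oplus\mathcal{H}_2$ is polynomially bounded, and $\mathcal{J}$ is the space of operators of the form $T_1L-LT_2$ with $L:\mathcal{H}_2\to\mathcal{H}_1$ bounded. *)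

(* Defs.v *)
From HB Require Import structures.
From mathcomp Require Import all_boot all_order all_algebra complex.
From mathcomp Require Import sesquilinear ring_quotient generic_quotient.
From mathcomp Require Import all_classical all_reals all_analysis.
From mathcomp Require Import ring.

Set Implicit Arguments.
Unset Strict Implicit.
Unset Printing Implicit Defensive.

Import Order.TTheory GRing.Theory Num.Theory.
Import numFieldNormedType.Exports.

Local Open Scope classical_set_scope.
Local Open Scope ring_scope.
Local Open Scope quotient_scope.

(* The norm of a normed module over R[i] takes its values in R[i] (it is a
   nonnegative real there); [inner] is linear in its first argument and
   conjugate-linear in the second. *)
HB.mixin Record isHilbert (R : realType) H & CompleteNormedModule R[i] H := {
  inner : {dot H for (Num.conj : R[i] -> R[i])};
  inner_norm : forall x : H, `|x| = sqrtC (inner x x)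
}.

#[short(type="hilbertType")]
HB.structure Definition Hilbert (R : realType) :=
  {H of isHilbert R H & CompleteNormedModule R[i] H}.

Section BoundedOperators.
Context {R : realType}.

(* A linear map is bounded iff it is continuous, see
   [linear_bounded_continuous]. *)
Definition bounded_operator (H1 H2 : normedModType R[i]) : {pred H1 -> H2} :=
  [pred f : H1 -> H2 | `[< linear f /\ continuous f >]].

Lemma bounded_operator_submod (H1 H2 : normedModType R[i]) :
  submod_closed (@bounded_operator H1 H2).
Proof.
split.
  apply/asboolP; split; first by move=> a x y; rewrite /= scaler0 addr0.
  exact: cst_continuous.
move=> a f g /asboolP[lf cf] /asboolP[lg cg]; apply/asboolP; split.
  move=> b x y; rewrite /= !fctE lf lg !scalerDr !scalerA [a * b]mulrC.
  by rewrite addrACA.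
by move=> x; apply: cvgD; [apply: cvgZr; exact: cf | exact: cg].
Qed.

HB.instance Definition _ (H1 H2 : normedModType R[i]) :=
  GRing.isSubmodClosed.Build R[i] (H1 -> H2) (@bounded_operator H1 H2)
    (@bounded_operator_submod H1 H2).

Record bop (H1 H2 : normedModType R[i]) := Bop {
  bop_fun :> H1 -> H2;
  bopP : bop_fun \in @bounded_operator H1 H2
}.

HB.instance Definition _ H1 H2 := [isSub for @bop_fun H1 H2].
HB.instance Definition _ H1 H2 := [Choice of bop H1 H2 by <:].
HB.instance Definition _ H1 H2 :=
  [SubChoice_isSubLmodule of bop H1 H2 by <:].

End BoundedOperators.

Section BopTheory.
Context {R : realType} {H1 H2 : normedModType R[i]}.

Lemma bop_linear (f : bop H1 H2) : linear f.
Proof. by case: f => f /= /asboolP[]. Qed.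

Lemma bop_continuous (f : bop H1 H2) : continuous f.
Proof. by case: f => f /= /asboolP[]. Qed.

HB.instance Definition _ (f : bop H1 H2) :=
  GRing.isLinear.Build R[i] H1 H2 _ f (@bop_linear f).

Lemma bopE (f g : bop H1 H2) : (forall x, f x = g x) -> f = g.
Proof. by move=> fg; apply: val_inj; apply/funext. Qed.

End BopTheory.

Section BopComp.
Context {R : realType}.

Lemma bop_id_subproof (H : normedModType R[i]) :
  (idfun : H -> H) \in @bounded_operator R H H.
Proof. by apply/asboolP; split => // x; exact: cvg_id. Qed.

Definition bop_id {H : normedModType R[i]} : bop H H :=
  Bop (bop_id_subproof H).

Lemma bop_comp_subproof (H1 H2 H3 : normedModType R[i])
    (g : bop H2 H3) (f : bop H1 H2) :
  g \o f \in @bounded_operator R H1 H3.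
Proof.
apply/asboolP; split; first by move=> a x y; rewrite /= !linearP.
by move=> x; apply: continuous_comp; exact: bop_continuous.
Qed.

Definition bop_comp {H1 H2 H3 : normedModType R[i]}
  (g : bop H2 H3) (f : bop H1 H2) : bop H1 H3 := Bop (bop_comp_subproof g f).

Definition bop_pow {H : normedModType R[i]} (T : bop H H) (n : nat) : bop H H :=
  iter n (bop_comp T) bop_id.

(* p(T) *)
Definition bop_horner {H : normedModType R[i]} (p : {poly R[i]}) (T : bop H H) :
    bop H H :=
  \sum_(i < size p) p`_i *: bop_pow T i.

(* Norms and moduli are elements of R[i]; their real parts are taken so that
   the suprema live in R. *)
Definition opnorm {H1 H2 : normedModType R[i]} (f : bop H1 H2) : R :=
  sup [set complex.Re `|f x| | x in [set x | `|x| <= 1]].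

Definition disc_sup (p : {poly R[i]}) : R :=
  sup [set complex.Re `|p.[z]| | z in [set z | `|z| < 1]].

Definition polynomially_bounded {H : normedModType R[i]} (T : bop H H) : Prop :=
  exists2 C : R, 0 < C & forall p, opnorm (bop_horner p T) <= C * disc_sup p.

End BopComp.

Section HilbertSum.
Context {R : realType}.

(* The Hilbert space direct sum. The alias keeps the Euclidean norm
   sqrt(|x|^2 + |y|^2) apart from the max norm carried by [(H1 * H2)%type]. *)
Definition hsum (H1 H2 : hilbertType R) : Type := (H1 * H2)%type.

Variables H1 H2 : hilbertType R.
Local Notation H := (hsum H1 H2).

HB.instance Definition _ := GRing.Lmodule.copy H (H1 * H2)%type.

Definition hsum_inner (u v : H) : R[i] := inner u.1 v.1 + inner u.2 v.2.

Lemma hsum_inner_bilinear :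
  bilinear_for *%R (Num.conj \; *%R) hsum_inner.
Proof.
split=> [v a x y | u a x y] /=; rewrite /hsum_inner /=.
  rewrite !linearDl/= !linearZl_LR /= addrACA; congr (_ + _).
  by symmetry; exact: mulrDr.
by rewrite !linearDr/= !linearZr_LR /= addrACA; congr (_ + _).
Qed.

HB.instance Definition _ := bilinear_isBilinear.Build R[i] H H R[i] *%R
  (Num.conj \; *%R) hsum_inner hsum_inner_bilinear.

Lemma hsum_inner_hermitian (u v : H) :
  hsum_inner u v = (-1) ^+ false * Num.conj (hsum_inner v u).
Proof.
rewrite /hsum_inner (hermC _ u.1) (hermC _ u.2) /= !expr0 !mul1r.
by rewrite rmorphD.
Qed.

HB.instance Definition _ := isHermitianSesquilinear.Build R[i] H false
  Num.conj hsum_inner hsum_inner_hermitian.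

Lemma hsum_inner_gt0 (u : H) : u != 0 -> 0 < hsum_inner u u.
Proof.
move=> u0; rewrite /hsum_inner lt_def addr_ge0 ?dnorm_ge0// andbT.
rewrite paddr_eq0 ?dnorm_ge0// !dnorm_eq0; apply: contra u0.
by case: u => a b /= /andP[/eqP-> /eqP->].
Qed.

HB.instance Definition _ := isDotProduct.Build R[i] H hsum_inner
  hsum_inner_gt0.

Definition hsum_norm (u : H) : R[i] := sqrtC (hsum_inner u u).

Lemma sqr_inner (K : hilbertType R) (x : K) : inner x x = `|x| ^+ 2.
Proof. by rewrite inner_norm sqrtCK. Qed.

Lemma hsum_normE (u : H) : hsum_norm u = sqrtC (`|u.1| ^+ 2 + `|u.2| ^+ 2).
Proof. by rewrite /hsum_norm /hsum_inner !sqr_inner. Qed.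

Lemma hsum_norm_sqr (u : H) : hsum_norm u ^+ 2 = `|u.1| ^+ 2 + `|u.2| ^+ 2.
Proof. by rewrite hsum_normE sqrtCK. Qed.

Lemma hsum_norm_ge0 (u : H) : 0 <= hsum_norm u.
Proof. by rewrite hsum_normE sqrtC_ge0 addr_ge0 ?exprn_ge0. Qed.

Lemma hsum_norm_le1 (u : H) : `|u.1| <= hsum_norm u.
Proof.
rewrite -(@ler_pXn2r _ 2)// ?nnegrE ?hsum_norm_ge0//.
by rewrite hsum_norm_sqr lerDl exprn_ge0.
Qed.

Lemma hsum_norm_le2 (u : H) : `|u.2| <= hsum_norm u.
Proof.
rewrite -(@ler_pXn2r _ 2)// ?nnegrE ?hsum_norm_ge0//.
by rewrite hsum_norm_sqr lerDr exprn_ge0.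
Qed.

Lemma hsum_norm_leD (u : H) : hsum_norm u <= `|u.1| + `|u.2|.
Proof.
rewrite -(@ler_pXn2r _ 2)// ?nnegrE ?hsum_norm_ge0 ?addr_ge0//.
by rewrite hsum_norm_sqr sqrrD addrAC lerDl mulrn_wge0 ?mulr_ge0.
Qed.

Lemma hsum_norm_triangle (u v : H) :
  hsum_norm (u + v) <= hsum_norm u + hsum_norm v.
Proof.
rewrite -(@ler_pXn2r _ 2)// ?nnegrE ?addr_ge0 ?hsum_norm_ge0//.
rewrite sqrrD !hsum_norm_sqr /=.
have le1 : `|u.1 + v.1| ^+ 2 <= (`|u.1| + `|v.1|) ^+ 2.
  by rewrite ler_pXn2r ?nnegrE ?addr_ge0// ler_normD.
have le2 : `|u.2 + v.2| ^+ 2 <= (`|u.2| + `|v.2|) ^+ 2.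
  by rewrite ler_pXn2r ?nnegrE ?addr_ge0// ler_normD.
apply: le_trans (lerD le1 le2) _.
suff CS : `|u.1| * `|v.1| + `|u.2| * `|v.2| <= hsum_norm u * hsum_norm v.
  set a := `|u.1| in CS *; set b := `|v.1| in CS *.
  set c := `|u.2| in CS *; set d := `|v.2| in CS *.
  have -> : (a + b) ^+ 2 + (c + d) ^+ 2 =
      a ^+ 2 + c ^+ 2 + (a * b + c * d) *+ 2 + (b ^+ 2 + d ^+ 2) by ring.
  by rewrite lerD2r lerD2l ler_pMn2r.
rewrite -(@ler_pXn2r _ 2)// ?nnegrE ?addr_ge0 ?mulr_ge0 ?hsum_norm_ge0//.
rewrite exprMn !hsum_norm_sqr -subr_ge0.
set a := `|u.1|; set b := `|v.1|; set c := `|u.2|; set d := `|v.2|.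
have -> : (a ^+ 2 + c ^+ 2) * (b ^+ 2 + d ^+ 2) - (a * b + c * d) ^+ 2 =
  (a * d - c * b) ^+ 2 by ring.
by rewrite real_exprn_even_ge0// rpredB// rpredM// ger0_real ?normr_ge0.
Qed.

Lemma hsum_normZ (a : R[i]) (u : H) : hsum_norm (a *: u) = `|a| * hsum_norm u.
Proof.
by rewrite /hsum_norm dnormZ sqrtCM ?nnegrE ?exprn_ge0 ?dnorm_ge0// sqrCK.
Qed.

Lemma hsum_norm_eq0 (u : H) : hsum_norm u = 0 -> u = 0.
Proof. by move/eqP; rewrite sqrt_dnorm_eq0 => /eqP. Qed.

HB.instance Definition _ := Lmodule_isNormed.Build R[i] H
  hsum_norm_triangle hsum_normZ hsum_norm_eq0.

Lemma hsum_complete (F : set_system H) : ProperFilter F -> cauchy F -> cvg F.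
Proof.
move=> FF /cauchy_ballP Fc.
have c1 : cauchy ((fun x : H => x.1) @ F).
  apply/cauchy_ballP => e e0; have := Fc e e0.
  case=> -[A B] /= [FA FB] AB; exists ((fun x : H => x.1) @` A, (fun x : H => x.1) @` B) => /=.
    by split; [apply: filterS FA | apply: filterS FB] => x Ax; exists x.
  move=> [_ _] /= [[x Ax <-] [y By <-]].
  have /= := AB (x, y) (conj Ax By).
  rewrite -!ball_normE /= => h; apply: le_lt_trans h.
  exact: (hsum_norm_le1 (x - y)).
have c2 : cauchy ((fun x : H => x.2) @ F).
  apply/cauchy_ballP => e e0; have := Fc e e0.
  case=> -[A B] /= [FA FB] AB; exists ((fun x : H => x.2) @` A, (fun x : H => x.2) @` B) => /=.
    by split; [apply: filterS FA | apply: filterS FB] => x Ax; exists x.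
  move=> [_ _] /= [[x Ax <-] [y By <-]].
  have /= := AB (x, y) (conj Ax By).
  rewrite -!ball_normE /= => h; apply: le_lt_trans h.
  exact: (hsum_norm_le2 (x - y)).
have [l1 l1P] : exists l : H1, x.1 @[x --> F] --> l.
  by apply/cvg_ex; exact: (@cauchy_cvg H1).
have [l2 l2P] : exists l : H2, x.2 @[x --> F] --> l.
  by apply/cvg_ex; exact: (@cauchy_cvg H2).
apply/cvg_ex; exists ((l1, l2) : H).
apply/cvgrPdist_lt => e e0.
have e2 : 0 < e / 2 by rewrite divr_gt0.
have n1 := @cvgr_dist_lt _ _ _ _ _ _ _ l1P _ e2.
have n2 := @cvgr_dist_lt _ _ _ _ _ _ _ l2P _ e2.
near=> x.
apply: le_lt_trans (hsum_norm_leD ((l1, l2) - x : H)) _.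
rewrite (splitr e) ltrD//=; near: x.
  exact: n1.
exact: n2.
Unshelve. all: by end_near. Qed.

HB.instance Definition _ := Uniform_isComplete.Build H hsum_complete.

HB.instance Definition _ :=
  isHilbert.Build R H (inner := hsum_inner : {dot _ for _}) (fun=> erefl).

End HilbertSum.

Section BlockOperator.
Context {R : realType}.

Lemma lipschitz_bop (U V : normedModType R[i]) (f : U -> V) :
  linear f -> (forall x, `|f x| <= `|x|) -> f \in @bounded_operator R U V.
Proof.
move=> lf f1; apply/asboolP; split=> // x.
pose g : {linear U -> V} := HB.pack f (GRing.isLinear.Build R[i] U V _ f lf).
apply/cvgrPdist_lt => e e0; near=> y.
have -> : f x - f y = f (x - y) by rewrite -[f]/(g : U -> V) -linearB.
apply: le_lt_trans (f1 _) _; near: y.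
exact: (@cvgr_dist_lt _ _ _ _ _ id x).
Unshelve. all: by end_near. Qed.

Context {H1 H2 : hilbertType R}.
Local Notation H := (hsum H1 H2).

Lemma hsum_fst_subproof : (fun u : H => u.1) \in @bounded_operator R H H1.
Proof. by apply: lipschitz_bop => // u; exact: hsum_norm_le1. Qed.

Lemma hsum_snd_subproof : (fun u : H => u.2) \in @bounded_operator R H H2.
Proof. by apply: lipschitz_bop => // u; exact: hsum_norm_le2. Qed.

Lemma hsum_inl_subproof : (fun x : H1 => (x, 0) : H) \in @bounded_operator R H1 H.
Proof.
apply: lipschitz_bop => [a x y|x]; first by congr pair; rewrite /= ?scaler0 ?addr0.
by apply: le_trans (hsum_norm_leD _) _; rewrite /= normr0 addr0.
Qed.

Lemma hsum_inr_subproof : (fun y : H2 => (0, y) : H) \in @bounded_operator R H2 H.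
Proof.
apply: lipschitz_bop => [a x y|x]; first by congr pair; rewrite /= ?scaler0 ?addr0.
by apply: le_trans (hsum_norm_leD _) _; rewrite /= normr0 add0r.
Qed.

Lemma block_op_subproof (T1 : bop H1 H1) (X : bop H2 H1) (T2 : bop H2 H2) :
  (fun u : H => (T1 u.1 + X u.2, T2 u.2) : H) \in @bounded_operator R H H.
Proof.
pose i1 := Bop hsum_inl_subproof; pose i2 := Bop hsum_inr_subproof.
pose p1 := Bop hsum_fst_subproof; pose p2 := Bop hsum_snd_subproof.
pose S : bop H H := bop_comp i1 (bop_comp T1 p1 + bop_comp X p2)
                    + bop_comp i2 (bop_comp T2 p2).
suff -> : (fun u : H => (T1 u.1 + X u.2, T2 u.2) : H) = S by exact: bopP.
by apply/funext => u; congr pair; rewrite /= ?addr0 ?add0r.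
Qed.

(* The operator matrix [[T1, X], [0, T2]] on the Hilbert space direct sum. *)
Definition block_op (T1 : bop H1 H1) (X : bop H2 H1) (T2 : bop H2 H2) :
  bop H H := Bop (block_op_subproof T1 X T2).

End BlockOperator.

Section PolynomialBounds.
Context {R : realType}.
Implicit Types H : normedModType R[i].

Lemma norm_ReE H (x : H) : `|x| = (complex.Re `|x|)%:C%C.
Proof. by rewrite RRe_real// normr_real. Qed.

Lemma opnorm_has_sup H1 H2 (f : bop H1 H2) :
  has_sup [set complex.Re `|f x| | x in [set x | `|x| <= 1]].
Proof.
split; first by exists (complex.Re `|f 0|), 0 => //=; rewrite normr0.
have /linear_boundedP/pinfty_ex_gt0[r r0 fr] :=
  proj2 (@linear_bounded_continuous _ _ _ f) (@bop_continuous _ _ _ f).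
exists (complex.Re r) => _ [x /= x1 <-].
have : `|f x| <= r by apply: le_trans (fr x) _; rewrite ger_pMr.
by rewrite lecE => /andP[].
Qed.

Lemma opnorm_ge0 H1 H2 (f : bop H1 H2) : 0 <= opnorm f.
Proof.
apply: (sup_upper_bound (opnorm_has_sup f)).
by exists 0; rewrite /= ?normr0 ?linear0 ?normr0.
Qed.

Lemma opnorm_bound H1 H2 (f : bop H1 H2) (c : R) (x : H1) :
  opnorm f <= c -> `|f x| <= c%:C%C * `|x|.
Proof.
move=> fc; have [->|x0] := eqVneq x 0.
  by rewrite linear0 !normr0 mulr0.
have xp : 0 < `|x| by rewrite normr_gt0.
have fy : `|f (`|x|^-1 *: x)| <= c%:C%C.
  rewrite norm_ReE lecR; apply: le_trans fc.
  apply: (sup_upper_bound (opnorm_has_sup f)).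
  exists (`|x|^-1 *: x) => //=.
  by rewrite normrZ ger0_norm ?invr_ge0// mulVf ?gt_eqF.
move: fy; rewrite linearZ normrZ ger0_norm ?invr_ge0//.
by rewrite ler_pdivrMl// mulrC.
Qed.

Lemma opnorm_le H1 H2 (f : bop H1 H2) (c : R) : 0 <= c ->
  (forall x, `|f x| <= c%:C%C * `|x|) -> opnorm f <= c.
Proof.
move=> c0 fc; apply: ge_sup; first by case: (opnorm_has_sup f).
move=> _ [x /= x1 <-]; rewrite -lecR -norm_ReE.
by apply: le_trans (fc x) _; rewrite ler_piMr// lecR.
Qed.

Lemma disc_sup_ge0 (p : {poly R[i]}) : 0 <= disc_sup p.
Proof.
rewrite /disc_sup; set A := (X in sup X).
have [hA|/sup_out->//] := pselect (has_sup A).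
apply: (@le_trans _ _ (complex.Re `|p.[0]|)).
  by rewrite -lecR RRe_real ?normr_real//; exact: normr_ge0.
by apply: (sup_upper_bound hA); exists 0 => //=; rewrite normr0.
Qed.

Lemma polynomially_boundedP H (T : bop H H) : polynomially_bounded T <->
  exists2 C : R, 0 < C &
    forall p x, `|bop_horner p T x| <= (C * disc_sup p)%:C%C * `|x|.
Proof.
split=> -[C C0 h]; exists C => // p; first by move=> x; exact: opnorm_bound.
by apply: opnorm_le => //; rewrite mulr_ge0 ?disc_sup_ge0// ltW.
Qed.

Lemma bop_hornerE H (T : bop H H) p x :
  bop_horner p T x = \sum_(i < size p) p`_i *: bop_pow T i x.
Proof.
rewrite /bop_horner.
by elim/big_ind2 : _ => // a b c d <- <-.
Qed.

End PolynomialBounds.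

(* [is_adjoint T S] says that S is the adjoint of T; an S : bop H H exists by
   the Riesz representation theorem and is unique ([is_adjoint_unique]). *)
Definition is_adjoint {R : realType} {H : hilbertType R} (T S : bop H H) :=
  forall x y : H, inner (T x) y = inner x (S y).

Lemma is_adjoint_unique {R : realType} {H : hilbertType R} (T S S' : bop H H) :
  is_adjoint T S -> is_adjoint T S' -> S = S'.
Proof.
move=> TS TS'; apply: bopE => y; apply/eqP; rewrite -subr_eq0.
rewrite -(dnorm_eq0 (inner : {dot H for _})) [X in X == _]linearBr /=.
by rewrite -TS -TS' subrr.
Qed.

Definition normal_bop {R : realType} {H : hilbertType R} (T : bop H H) : Prop :=
  exists2 S : bop H H, is_adjoint T S & bop_comp T S = bop_comp S T.

Definition unitary_bop {R : realType} {H : hilbertType R} (T : bop H H) : Prop :=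
  exists2 S : bop H H, is_adjoint T S &
    bop_comp S T = bop_id /\ bop_comp T S = bop_id.

Record hilbertModule (R : realType) := HilbertModule {
  hm_space :> hilbertType R;
  hm_op : bop hm_space hm_space;
  hm_bounded : polynomially_bounded hm_op
}.

Section Ext.
Context {R : realType}.

Section PolyBoundedExtension.
Context {H1 H2 : hilbertType R}.
Variables (T1 : bop H1 H1) (T2 : bop H2 H2).
Local Notation blk X := (block_op T1 X T2).

(* The space A of the X for which [[T1, X], [0, T2]] is polynomially bounded. *)
Definition ext_bounded : {pred bop H2 H1} :=
  [pred X : bop H2 H1 | `[< polynomially_bounded (blk X) >]].

Lemma bop_powS (H : normedModType R[i]) (T : bop H H) n x :
  bop_pow T n.+1 x = T (bop_pow T n x).
Proof. by []. Qed.

Lemma block_pow2 X n u : (bop_pow (blk X) n u).2 = bop_pow T2 n u.2.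
Proof. by elim: n => // n IH; rewrite !bop_powS /= IH. Qed.

Lemma block_powB X Y n u : bop_pow (blk (X - Y)) n u =
  bop_pow (blk X) n u - bop_pow (blk Y) n u + bop_pow (blk 0) n u.
Proof.
elim: n => [|n IH]; first by rewrite /= subrr add0r.
rewrite !bop_powS IH /=; congr pair; rewrite /= !block_pow2; last first.
  by rewrite !linearD linearN /= subrr !add0r.
rewrite subrr add0r !linearD linearN /=.
set s := bop_pow T2 n _.
rewrite [Z in _ + Z = _](_ : _ = X s - Y s)//.
rewrite [Z in _ = _ + (_ + Z)](_ : _ = 0)// addr0.
by rewrite [LHS]addrAC; congr (_ + _); exact: addrACA.
Qed.

Definition ext_delta (L : bop H2 H1) : bop H2 H1 :=
  bop_comp T1 L - bop_comp L T2.

Lemma ext_deltaE L x : ext_delta L x = T1 (L x) - L (T2 x).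
Proof. by []. Qed.

Lemma ext_delta0 : ext_delta 0 = 0.
Proof.
apply: bopE => x; rewrite ext_deltaE.
rewrite [Z in T1 Z](_ : _ = 0)// [Z in _ - Z](_ : _ = 0)//.
by rewrite linear0 subrr.
Qed.

Lemma ext_deltaB L L' : ext_delta (L - L') = ext_delta L - ext_delta L'.
Proof.
apply: bopE => x; rewrite ext_deltaE.
rewrite [RHS](_ : _ = ext_delta L x - ext_delta L' x)// !ext_deltaE.
rewrite [Z in T1 Z](_ : _ = L x - L' x)//.
rewrite [Z in _ - Z = _](_ : _ = L (T2 x) - L' (T2 x))//.
by rewrite linearB !opprD !opprK addrACA.
Qed.

Lemma block_pow_delta L n u : bop_pow (blk (ext_delta L)) n u =
  (bop_pow T1 n (u.1 + L u.2) - L (bop_pow T2 n u.2), bop_pow T2 n u.2).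
Proof.
elim: n => [|n IH]; first by rewrite /= addrK; case: u.
rewrite bop_powS IH /=; congr pair.
set w := bop_pow T2 n _.
rewrite [Z in _ + Z = _](_ : _ = T1 (L w) - L (T2 w))//.
by rewrite linearB /= addrA subrK.
Qed.

Hypotheses (pb1 : polynomially_bounded T1) (pb2 : polynomially_bounded T2).

Lemma ext_bounded_delta L : ext_delta L \in ext_bounded.
Proof.
apply/asboolP/polynomially_boundedP.
have /polynomially_boundedP[C1 C10 h1] := pb1.
have /polynomially_boundedP[C2 C20 h2] := pb2.
pose l := opnorm L; have l0 : 0 <= l := opnorm_ge0 L.
have hL x : `|L x| <= l%:C%C * `|x| by apply: opnorm_bound.
exists ((C1 + C2) * (1 + l)).
  by apply: mulr_gt0; [exact: addr_gt0 | exact: ltr_pwDl].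
move=> p u; rewrite bop_hornerE.
have -> : \sum_(i < size p) p`_i *: bop_pow (blk (ext_delta L)) i u =
    (bop_horner p T1 (u.1 + L u.2) - L (bop_horner p T2 u.2),
     bop_horner p T2 u.2).
  rewrite !bop_hornerE linear_sum -sumrB.
  elim/big_ind3 : _ => // [a b c d e f -> ->//|i _].
  by rewrite block_pow_delta linearZ /= -scalerBr.
apply: le_trans (hsum_norm_leD _) _ => /=.
pose s := disc_sup p; have s0 : 0 <= s := disc_sup_ge0 p.
pose N : R[i] := `|u|.
have k1 : 0 <= (C1 * s)%:C%C by rewrite lecR; apply: mulr_ge0 => //; exact: ltW.
have k2 : 0 <= (C2 * s)%:C%C by rewrite lecR; apply: mulr_ge0 => //; exact: ltW.
have b1 : `|bop_horner p T1 (u.1 + L u.2)| <= (C1 * s)%:C%C * ((1 + l)%:C%C * N).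
  apply: le_trans (h1 _ _) _; apply: ler_wpM2l k1 _ _ _.
  rewrite rmorphD mulrDl; apply: le_trans (ler_normD _ _) _.
  rewrite lerD// ?mul1r ?hsum_norm_le1//.
  by apply: le_trans (hL _) _; rewrite ler_wpM2l ?lecR ?hsum_norm_le2.
have b2 : `|bop_horner p T2 u.2| <= (C2 * s)%:C%C * N.
  apply: le_trans (h2 _ _) _; apply: ler_wpM2l k2 _ _ _.
  exact: hsum_norm_le2.
have b3 : `|L (bop_horner p T2 u.2)| <= l%:C%C * ((C2 * s)%:C%C * N).
  by apply: le_trans (hL _) _; rewrite ler_wpM2l ?lecR.
apply: le_trans (lerD (le_trans (ler_normB _ _) (lerD b1 b3)) b2) _.
rewrite -/s -/N le_eqVlt; apply/orP; left; apply/eqP.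
rewrite !(rmorphM, rmorphD, rmorph1).
by ring.
Qed.

Lemma ext_bounded0 : 0 \in ext_bounded.
Proof. by rewrite -ext_delta0 ext_bounded_delta. Qed.

Lemma ext_bounded_zmod : zmod_closed ext_bounded.
Proof.
split; first exact: ext_bounded0.
move=> X Y /asboolP/polynomially_boundedP[C1 C10 h1].
move=> /asboolP/polynomially_boundedP[C2 C20 h2].
have /asboolP/polynomially_boundedP[C3 C30 h3] := ext_bounded0.
apply/asboolP/polynomially_boundedP; exists (C1 + C2 + C3).
  by rewrite !addr_gt0.
move=> p u.
have -> : bop_horner p (blk (X - Y)) u = bop_horner p (blk X) u -
    bop_horner p (blk Y) u + bop_horner p (blk 0) u.
  rewrite !bop_hornerE -sumrB -big_split /=; apply: eq_bigr => i _.
  by rewrite block_powB scalerDr scalerBr.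
rewrite !mulrDl !rmorphD !mulrDl.
apply: le_trans (ler_normD _ _) _; rewrite lerD//.
by apply: le_trans (ler_normB _ _) _; rewrite lerD.
Qed.

End PolyBoundedExtension.

Variables M2 M1 : hilbertModule R.

Definition ext_space : {pred bop M2 M1} := ext_bounded (hm_op M1) (hm_op M2).

HB.instance Definition _ := GRing.isZmodClosed.Build (bop M2 M1) ext_space
  (ext_bounded_zmod (@hm_bounded _ M1) (@hm_bounded _ M2)).

Record ext_cocycle := ExtCocycle {
  ext_val :> bop M2 M1;
  ext_valP : ext_val \in ext_space
}.

HB.instance Definition _ := [isSub for ext_val].
HB.instance Definition _ := [Choice of ext_cocycle by <:].
HB.instance Definition _ := [SubChoice_isSubZmodule of ext_cocycle by <:].

Definition ext_coboundary : {pred ext_cocycle} :=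
  [pred X : ext_cocycle | `[< exists L : bop M2 M1,
     val X = bop_comp (hm_op M1) L - bop_comp L (hm_op M2) >]].

Lemma ext_coboundary_zmod : zmod_closed ext_coboundary.
Proof.
split; first by apply/asboolP; exists 0; rewrite [RHS]ext_delta0.
move=> X Y /asboolP[L XL] /asboolP[L' YL']; apply/asboolP; exists (L - L').
by rewrite raddfB /= XL YL' [RHS]ext_deltaB.
Qed.

HB.instance Definition _ :=
  GRing.isZmodClosed.Build ext_cocycle ext_coboundary ext_coboundary_zmod.

(* Hence [ext_coboundary] consists of all the operators T1 L - L T2. *)
Lemma ext_coboundary_full (L : bop M2 M1) :
  bop_comp (hm_op M1) L - bop_comp L (hm_op M2) \in ext_space.
Proof. exact: (ext_bounded_delta (@hm_bounded _ M1) (@hm_bounded _ M2)). Qed.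

Definition Ext1 : zmodType := Quotient.quot ext_coboundary.

Lemma Ext1_trivialP : (forall x : Ext1, x = 0) <->
  forall X : bop M2 M1,
    polynomially_bounded (block_op (hm_op M1) X (hm_op M2)) ->
    exists L : bop M2 M1,
      X = bop_comp (hm_op M1) L - bop_comp L (hm_op M2).
Proof.
have pi0 (X : ext_cocycle) :
    (\pi_(Quotient.quot ext_coboundary) X = 0) <-> X \in ext_coboundary.
  rewrite -[X in X \in _]subr0 Quotient.idealrBE.
  have -> : 0 = \pi_(Quotient.quot ext_coboundary) 0 by rewrite piE.
  by split => [->//|/eqP].
split=> [E0 X hX | h x].
  have Xs : X \in ext_space by apply/asboolP.
  have := E0 (\pi_(Quotient.quot ext_coboundary) (ExtCocycle Xs)).
  by move=> /pi0/asboolP.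
rewrite -[x](@reprK _ (Quotient.quot ext_coboundary)).
apply/pi0/asboolP; apply: h; exact/asboolP/ext_valP.
Qed.

End Ext.

(* Main.v *)
Require Import Defs.
From HB Require Import structures.
From mathcomp Require Import all_boot all_order all_algebra complex.
From mathcomp Require Import sesquilinear.
From mathcomp Require Import all_classical all_reals all_analysis.
From mathcomp Require Import ring lra zify.

Set Implicit Arguments.
Unset Strict Implicit.
Unset Printing Implicit Defensive.

Import Order.TTheory GRing.Theory Num.Theory.
Import numFieldNormedType.Exports.

Local Open Scope classical_set_scope.
Local Open Scope ring_scope.

(** Let [T] be normal and polynomially bounded, with adjoint [S].

    If [T] is unitary, let [X] be a cocycle. The corner of the n-th power of
    the block operator [[T, X], [0, T]] is a sum of terms T^i X T^j with
    i + j = n - 1; it is bounded in n, and so is its product Y_n with S^n ([rotated_corner]).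
    The recurrence T Y_(n+1) = X + Y_n T says that a shift-invariant limit [L]
    of the Y_n satisfies T L = X + L T. Such a limit is obtained by taking
    Cesaro means, which makes the effect of the shift vanish, and then the weak
    limit of these means along an ultrafilter ([unitary_cocycle_trivial]). Weak
    limits along an ultrafilter exist because a bounded real functional on a
    Hilbert space is an inner product ([riesz_real]).

    If [T] is not unitary, its defect D = 1 - S T is nonzero, and X = D^3 is a
    cocycle that is not a coboundary. As T is normal, the squares
    a_n = |T^n x|^2 have second differences |T^n D x|^2, so they form a convex
    bounded sequence. Hence T is a contraction and |T^n D x| = O(1/n)
    ([defect_decay]), which gives |T^n D^3 x| = O(1/n^3). Since X commutes with
    T, the corner of p(block) is p'(T) X, the sum of the p_n n T^(n-1) X. The
    coefficients of p are bounded by its supremum on the disc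
    ([coef_le_disc_sup]) and the series of the n / n^3 converges, so the block
    operator is polynomially bounded ([block_polynomially_bounded]). If X were
    T L - L T, it would be a commutator that commutes with T, so X^n would
    decay like k^n / n! by the Kleinecke-Shirokov argument
    ([iter_commutator_exp]). A self-adjoint operator with such powers is 0
    ([selfadjoint_commutator_eq0]), and then D = 0. *)

(** * Real-valued norm and inner product *)

Lemma normc_ReE (R : realType) (z : R[i]) : `|z| = (complex.Re `|z|)%:C%C.
Proof. by rewrite RRe_real// normr_real. Qed.

Section RealNorm.
Context {R : realType} {V : normedModType R[i]}.
Implicit Types x y : V.

(** Norms take values in R[i], whose order is partial; estimates are carried
    out on real parts, where the order is total. *)
Definition rnorm x : R := complex.Re `|x|.

Lemma rnormE x : `|x| = (rnorm x)%:C%C.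
Proof. exact: norm_ReE. Qed.

Lemma rnorm_ge0 x : 0 <= rnorm x.
Proof. by rewrite -lecR -rnormE normr_ge0. Qed.

Lemma rnorm0 : rnorm (0 : V) = 0.
Proof. by rewrite /rnorm normr0. Qed.

Lemma rnorm0_eq0 x : rnorm x = 0 -> x = 0.
Proof. by move=> x0; apply/normr0_eq0; rewrite rnormE x0. Qed.

Lemma rnormD x y : rnorm (x + y) <= rnorm x + rnorm y.
Proof. by rewrite -lecR rmorphD /= -!rnormE ler_normD. Qed.

Lemma rnormN x : rnorm (- x) = rnorm x.
Proof. by rewrite /rnorm normrN. Qed.

Lemma rnormB x y : rnorm (x - y) <= rnorm x + rnorm y.
Proof. by rewrite -(rnormN y); exact: rnormD. Qed.

Lemma rnormZ (a : R[i]) x : rnorm (a *: x) = complex.Re `|a| * rnorm x.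
Proof. by apply: complexI; rewrite rmorphM /= -normc_ReE -!norm_ReE normrZ. Qed.

Lemma rnormZr (t : R) x : rnorm (t%:C%C *: x) = `|t| * rnorm x.
Proof. by rewrite rnormZ normc_def /= expr0n /= addr0 sqrtr_sqr. Qed.

Lemma rnorm_sum (I : Type) (r : seq I) (P : pred I) (F : I -> V) :
  rnorm (\sum_(i <- r | P i) F i) <= \sum_(i <- r | P i) rnorm (F i).
Proof.
elim/big_rec2 : _ => [|i y v _ h]; first by rewrite rnorm0.
by apply: le_trans (rnormD _ _) _; rewrite lerD2l.
Qed.

End RealNorm.

Lemma bop_rnorm_bound (R : realType) (V W : normedModType R[i]) (f : bop V W)
  (x : V) : rnorm (f x) <= opnorm f * rnorm x.
Proof. by rewrite -lecR rmorphM /= -!rnormE opnorm_bound. Qed.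

Section RealInner.
Context {R : realType} {H : hilbertType R}.
Implicit Types x y z : H.

Definition rinner x y : R := complex.Re (inner x y).

Lemma Re_add (a b : R[i]) : complex.Re (a + b) = complex.Re a + complex.Re b.
Proof. by case: a b => [? ?] []. Qed.

Lemma Re_oppr (a : R[i]) : complex.Re (- a) = - complex.Re a.
Proof. by case: a. Qed.

Lemma rinnerC x y : rinner x y = rinner y x.
Proof.
rewrite /rinner (hermC inner x y) expr0 mul1r.
by rewrite -[X in complex.Re X]/((inner y x)^*)%C; case: (inner y x).
Qed.

Lemma rinnerDl x y z : rinner (x + y) z = rinner x z + rinner y z.
Proof. by rewrite /rinner linearDl/= Re_add. Qed.

Lemma rinnerDr x y z : rinner x (y + z) = rinner x y + rinner x z.
Proof. by rewrite rinnerC rinnerDl !(rinnerC x). Qed.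

Lemma rinnerNl x y : rinner (- x) y = - rinner x y.
Proof. by rewrite /rinner linearNl Re_oppr. Qed.

Lemma rinnerNr x y : rinner x (- y) = - rinner x y.
Proof. by rewrite rinnerC rinnerNl rinnerC. Qed.

Lemma rinnerZl (a : R[i]) x y : rinner (a *: x) y = rinner x (conjc a *: y).
Proof.
rewrite /rinner linearZl_LR linearZr_LR /=.
by congr (complex.Re (_ * _)); rewrite -[RHS]/((a^*)^*%C)%C conjcK.
Qed.

Lemma rinnerZr (t : R) x y : rinner x (t%:C%C *: y) = t * rinner x y.
Proof.
rewrite rinnerC (rinnerC x) /rinner linearZl_LR /=.
by case: (inner y x) => a b; rewrite /GRing.scale /= mul0r subr0.
Qed.

Lemma rinner_sqr x : rinner x x = rnorm x ^+ 2.
Proof.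
apply: complexI; rewrite rmorphXn /= -rnormE -sqr_inner /rinner RRe_real//.
by rewrite ger0_real// dnorm_ge0.
Qed.

Lemma rnormD_sqr x y :
  rnorm (x + y) ^+ 2 = rnorm x ^+ 2 + 2 * rinner x y + rnorm y ^+ 2.
Proof.
by rewrite -!rinner_sqr rinnerDl !rinnerDr (rinnerC y x); ring.
Qed.

Lemma rnormB_sqr x y :
  rnorm (x - y) ^+ 2 = rnorm x ^+ 2 - 2 * rinner x y + rnorm y ^+ 2.
Proof. by rewrite rnormD_sqr rinnerNr rnormN; ring. Qed.

(** The Cauchy-Schwarz inequality, from the squared norms of b x + a y and
    b x - a y with a = |x| and b = |y|. *)
Lemma rinner_le x y : `|rinner x y| <= rnorm x * rnorm y.
Proof.
have [->|x0] := eqVneq x 0.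
  by rewrite rnorm0 mul0r -(subrr (0 : H)) rinnerDl rinnerNl subrr normr0.
have [->|y0] := eqVneq y 0.
  by rewrite rnorm0 mulr0 -(subrr (0 : H)) rinnerDr rinnerNr subrr normr0.
have pos z : z != 0 -> 0 < rnorm z.
  move=> z0; rewrite lt_def rnorm_ge0 andbT.
  by apply: contra z0 => /eqP/rnorm0_eq0->.
have := pos _ x0; have := pos _ y0.
set a := rnorm x; set b := rnorm y => b0 a0.
have ab : 0 < a * b by exact: mulr_gt0.
have p := sqr_ge0 (rnorm (b%:C%C *: x + a%:C%C *: y)).
have m := sqr_ge0 (rnorm (b%:C%C *: x - a%:C%C *: y)).
rewrite rnormD_sqr !rnormZr !gtr0_norm// in p.
rewrite rnormB_sqr !rnormZr !gtr0_norm// in m.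
rewrite rinnerZr rinnerC rinnerZr rinnerC -/a -/b in p.
rewrite rinnerZr rinnerC rinnerZr rinnerC -/a -/b in m.
have p' : 0 <= (a * b) * (rinner x y + a * b).
  by rewrite -(pmulr_rge0 _ (ltr0Sn R 1)); apply: le_trans p _;
     rewrite le_eqVlt; apply/orP; left; apply/eqP; ring.
have m' : 0 <= (a * b) * (a * b - rinner x y).
  by rewrite -(pmulr_rge0 _ (ltr0Sn R 1)); apply: le_trans m _;
     rewrite le_eqVlt; apply/orP; left; apply/eqP; ring.
rewrite !pmulr_rge0// in p' m'.
by rewrite ler_norml; apply/andP; split; lra.
Qed.

Lemma rinner_inj x y : (forall z, rinner x z = rinner y z) -> x = y.
Proof.
move=> e; apply/eqP; rewrite -subr_eq0; apply/eqP/rnorm0_eq0/eqP.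
by rewrite -sqrf_eq0 -rinner_sqr rinnerDl rinnerNl e subrr.
Qed.

Lemma is_adjoint_rinner (T S : bop H H) x y : is_adjoint T S ->
  rinner (T x) y = rinner x (S y).
Proof. by move=> TS; rewrite /rinner TS. Qed.

End RealInner.

(** * Coefficients of polynomials bounded on the disc *)

Section CoefficientBound.

(** Cauchy's estimate, by induction on the degree instead of integration: p is
    E(z^2) + z O(z^2), where the even and odd parts E and O inherit the bounds
    M and M / r on the circle of radius r^2 from the averages of p(z) and
    p(-z), since every point of that circle is a square. *)
Lemma coef_le_circle (C : numClosedFieldType) (p : {poly C}) (r M : C) n :
    0 < r -> (forall z, `|z| = r -> `|p.[z]| <= M) -> `|p`_n| * r ^+ n <= M.
Proof.
have [k] := ubnP (size p); elim: k => // k IH in p r M n *.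
rewrite ltnS => szp r0 pM.
have M0 : 0 <= M by apply: le_trans (pM r (gtr0_norm r0)); exact: normr_ge0.
have [p1|p1] := leqP (size p) 1.
  rewrite (size1_polyC p1) coefC; case: eqP => [->|_].
    by rewrite expr0 mulr1 -(hornerC p`_0 r) -size1_polyC// pM// gtr0_norm.
  by rewrite normr0 mul0r.
have pE z : p.[z] = (even_poly p).[z ^+ 2] + (odd_poly p).[z ^+ 2] * z.
  by rewrite -{1}(poly_even_odd p) hornerD hornerMX !horner_comp hornerXn.
have half2 (w : C) : 2 * `|w| = `|w + w|.
  by rewrite -mulr2n normrMn mulr_natl.
have sqz w : `|w| = r ^+ 2 -> `|sqrtC w| = r.
  move=> wr; apply/eqP; rewrite -(@eqrXn2 _ 2)// ?ltW//.
  by rewrite -normrX sqrtCK wr.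
have two0 : 0 < 2 :> C by [].
have even_le w : `|w| = r ^+ 2 -> `|(even_poly p).[w]| <= M.
  move=> /sqz wr; set z := sqrtC w in wr.
  have zM : `|p.[z] + p.[- z]| <= M + M.
    by apply: le_trans (ler_normD _ _) _; rewrite lerD ?pM ?normrN.
  rewrite -(ler_pM2l two0) half2 mulr_natl; apply: le_trans zM.
  rewrite !pE sqrrN sqrtCK le_eqVlt; apply/orP; left; apply/eqP.
  by congr (`|_|); ring.
have odd_le w : `|w| = r ^+ 2 -> `|(odd_poly p).[w]| <= M / r.
  move=> /sqz wr; set z := sqrtC w in wr.
  have zM : `|p.[z] - p.[- z]| <= M + M.
    by apply: le_trans (ler_normB _ _) _; rewrite lerD ?pM ?normrN.
  rewrite ler_pdivlMr// -(ler_pM2l two0) -wr -normrM half2 mulr_natl.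
  apply: le_trans zM.
  rewrite !pE sqrrN sqrtCK le_eqVlt; apply/orP; left; apply/eqP.
  by congr (`|_|); ring.
have r20 : 0 < r ^+ 2 by rewrite exprn_gt0.
rewrite -(odd_double_half n); case: (odd n); rewrite /= ?add1n ?add0n.
- rewrite -coef_odd_poly exprS mulrCA mulrC -ler_pdivlMr// -muln2 mulnC exprM.
  apply: IH => //; apply: leq_ltn_trans (size_odd_poly p) _.
  by apply: leq_trans szp; lia.
- rewrite -coef_even_poly -muln2 mulnC exprM.
  apply: IH => //; apply: leq_ltn_trans (size_even_poly p) _.
  by apply: leq_trans szp; lia.
Qed.

Context {R : realType}.
Implicit Types p : {poly R[i]}.

Lemma disc_sup_bound p (z : R[i]) : `|z| < 1 -> `|p.[z]| <= (disc_sup p)%:C%C.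
Proof.
move=> z1; rewrite normc_ReE lecR; apply: sup_upper_bound; last by exists z.
split; first by exists (complex.Re `|p.[0]|), 0 => //=; rewrite normr0.
exists (complex.Re (\sum_(i < size p) `|p`_i|)) => _ [w /= w1 <-].
suff : `|p.[w]| <= \sum_(i < size p) `|p`_i| by rewrite lecE => /andP[].
rewrite horner_coef; apply: le_trans (ler_norm_sum _ _ _) _.
apply: ler_sum => i _; rewrite normrM normrX ler_piMr//.
by rewrite exprn_ile1// ltW.
Qed.

(** The estimate on circles of radius r < 1, in the limit r -> 1. *)
Lemma coef_le_disc_sup p n : complex.Re `|p`_n| <= disc_sup p.
Proof.
set c := complex.Re _.
pose r (m : nat) : R := 1 - m.+2%:R^-1.
have r01 m : 0 < r m < 1.
  rewrite /r subr_gt0 invf_lt1// ltr1n /= ltrBlDr ltrDl.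
  by rewrite invr_gt0 ltr0n.
have rle m : c * r m ^+ n <= disc_sup p.
  have /andP[r0 r1] := r01 m.
  rewrite -lecR rmorphM rmorphXn /= -normc_ReE.
  apply: coef_le_circle; first by rewrite ltcR.
  by move=> z zr; apply: disc_sup_bound; rewrite zr ltcR.
have rcvg : c * r m ^+ n @[m --> \oo] --> c * 1 ^+ n.
  apply: cvgMr; apply: (@continuous_cvg _ _ _ _ _ _ (fun x : R => x ^+ n)).
    exact: exprn_continuous.
  rewrite -[X in _ --> X]subr0; apply: cvgB; first exact: cvg_cst.
  by rewrite (cvg_shiftS (@harmonic R)); exact: cvg_harmonic.
rewrite -[c]mulr1 -(expr1n _ n); apply: (cvgr_to_le rcvg).
by near=> m; exact: rle.
Unshelve. all: by end_near. Qed.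

Lemma disc_sup_Xn_le1 n : disc_sup ('X^n : {poly R[i]}) <= 1.
Proof.
apply: ge_sup; first by exists (complex.Re `|'X^n.[0]|), 0; rewrite //= normr0.
move=> _ [z /= z1 <-]; rewrite -lecR -normc_ReE hornerXn normrX.
by rewrite exprn_ile1// ltW.
Qed.

End CoefficientBound.

(** * Convex and log-convex sequences, and commutators *)

Section RealSequences.
Context {R : realType}.
Implicit Types (a e : nat -> R).

(** A positive increment of a convex sequence would persist, and the sequence
    would grow linearly. *)
Lemma convex_bounded_nonincreasing a (K : R) :
  (forall n, 0 <= a n - 2 * a n.+1 + a n.+2) -> (forall n, a n <= K) ->
  forall n, a n.+1 <= a n.
Proof.
move=> cvx aK n; rewrite leNgt; apply/negP => an.
pose d := a n.+1 - a n; have d0 : 0 < d by rewrite subr_gt0.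
have grow k :
    d <= a (n + k).+1%N - a (n + k)%N /\ a n + k%:R * d <= a (n + k)%N.
  elim: k => [|k [IH1 IH2]].
    by rewrite addn0; split; rewrite /d ?mul0r ?addr0 lexx.
  by rewrite addnS -natr1 mulrDl mul1r; have := cvx (n + k)%N; split; lra.
have kd0 : 0 <= (`|K| + `|a n|) / d.
  by apply: divr_ge0; [exact: addr_ge0 | exact: ltW].
have := archi_boundP kd0.
set k := Num.bound _; rewrite ltr_pdivrMr// => kd.
have [_ h] := grow k; have := le_trans h (aK _).
have := ler_norm K; have := ler_norm (- a n); rewrite normrN; lra.
Qed.

(** Abel summation bounds the sum over i <= n of (i + 1) c_i by a_0, and the
    nonincreasing c makes this sum at least (n + 1)(n + 2)/2 times c_n. *)
Lemma convex_second_difference_decay a :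
  let c n := a n - 2 * a n.+1 + a n.+2 in
  (forall n, 0 <= a n) -> (forall n, a n.+1 <= a n) ->
  (forall n, c n.+1 <= c n) ->
  forall n, n.+1%:R ^+ 2 * c n <= 2 * a 0%N.
Proof.
move=> c a0 adec cdec n.
have c0 m : 0 <= c m -> n.+1%:R ^+ 2 * c m <= n.+1%:R * n.+2%:R * c m.
  by move=> ?; rewrite ler_wpM2r// expr2 ler_wpM2l// ler_nat.
have step m : m.+1%:R * m.+2%:R * c m <=
    2 * (a 0%N - m.+2%:R * a m.+1 + m.+1%:R * a m.+2).
  elim: m => [|m IH]; first by rewrite /c; lra.
  apply: (@le_trans _ _ (m.+1%:R * m.+2%:R * c m + 2 * m.+2%:R * c m.+1)).
    have -> : m.+2%:R * m.+3%:R * c m.+1 =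
       m.+1%:R * m.+2%:R * c m.+1 + 2 * m.+2%:R * c m.+1.
      by rewrite -[m.+3%:R]natr1 -[m.+2%:R]natr1; ring.
    by rewrite lerD2r ler_wpM2l// mulr_ge0.
  apply: le_trans (lerD IH (lexx _)) _.
  rewrite /c -[m.+3%:R]natr1 -[m.+2%:R]natr1 le_eqVlt.
  by apply/orP; left; apply/eqP; ring.
have [cn|/ltW cn] := leP 0 (c n); last first.
  apply: (@le_trans _ _ 0); last by rewrite mulr_ge0.
  by rewrite mulr_ge0_le0// exprn_ge0.
apply: le_trans (c0 _ cn) _; apply: le_trans (step n) _.
rewrite ler_pM2l// -[n.+2%:R]natr1.
have := a0 n.+1; have := ler_wpM2l (ler0n R n.+1) (adec n.+1); lra.
Qed.

(** A log-convex sequence with e_1 > 0 dominates a geometric one, and no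
    geometric sequence decays like k^n / n!. *)
Lemma log_convex_factorial_decay e (k : R) :
  (forall n, 0 <= e n) -> (forall n, e n.+1 ^+ 2 <= e n * e n.+2) ->
  (forall n, n`!%:R * e n <= k ^+ n * e 0%N) -> e 1%N = 0.
Proof.
move=> e0 lc dec.
have [z|z] := eqVneq (e 0%N) 0.
  apply/le_anti; rewrite e0 andbT.
  by have := dec 1%N; rewrite z mulr0 mul1r.
have p0 : 0 < e 0%N by rewrite lt_def z e0.
apply/eqP/negPn/negP => e1.
have p1 : 0 < e 1%N by rewrite lt_def e1 e0.
pose s := e 1%N / e 0; have s0 : 0 < s by rewrite divr_gt0.
have ratio n : 0 < e n /\ s * e n <= e n.+1.
  elim: n => [|n [IH1 IH2]]; first by rewrite divfK.
  have en1 : 0 < e n.+1 by apply: lt_le_trans IH2; rewrite mulr_gt0.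
  split=> //; rewrite -(ler_pM2l IH1); apply: le_trans (lc n).
  by rewrite mulrCA mulrA expr2 ler_pM2r.
have geo n : s ^+ n * e 0%N <= e n.
  elim: n => [|n IH]; first by rewrite expr0 mul1r.
  by have [_] := ratio n; apply: le_trans; rewrite exprS -mulrA ler_pM2l.
have big n : 1 <= exp_coeff (k / s) n.
  rewrite /exp_coeff /= ler_pdivlMr ?ltr0n ?fact_gt0// mul1r expr_div_n.
  rewrite ler_pdivlMr ?exprn_gt0// -(ler_pM2r p0).
  by rewrite -mulrA; apply: le_trans (dec n); rewrite ler_wpM2l.
have : (1 : R) <= 0.
  apply: (cvgr_to_ge (cvg_exp_coeff (k / s))).
  by near=> n; exact: big.
by rewrite ler10.
Unshelve. all: by end_near. Qed.

End RealSequences.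

Section KleineckeShirokov.
Context {E : pzRingType}.
Variables T L X : E.
Hypotheses (TL : T * L - L * T = X) (TX : T * X = X * T).

Definition commutator_with (Y : E) : E := T * Y - Y * T.
Local Notation delta := commutator_with.

Lemma commutator_withD Y Z : delta (Y + Z) = delta Y + delta Z.
Proof. by rewrite /delta mulrDr mulrDl opprD addrACA. Qed.

Lemma commutator_withMn Y n : delta (Y *+ n) = delta Y *+ n.
Proof. by rewrite /delta mulrnAr mulrnAl mulrnBl. Qed.

Lemma commutator_withM Y Z : delta (Y * Z) = delta Y * Z + Y * delta Z.
Proof.
by rewrite /delta mulrBl mulrBr !mulrA addrA subrK.
Qed.

(** The Leibniz formula has only two terms because the commutator with T maps
    L to X and X to 0. *)
Lemma iter_commutatorM n Y :
  iter n.+1 delta (L * Y) =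
  L * iter n.+1 delta Y + (X * iter n delta Y) *+ n.+1.
Proof.
have dX : delta X = 0 by rewrite /delta TX subrr.
have dL : delta L = X by [].
elim: n => [|n IH]; first by rewrite /= commutator_withM dL mulr1n addrC.
rewrite iterS IH commutator_withD commutator_withMn !commutator_withM dL dX.
by rewrite mul0r add0r addrAC -!iterS -mulrS addrC.
Qed.

(** The Kleinecke-Shirokov identity: applying the derivation n times to L^n
    leaves n! X^n. The vanishing of one more iterate is what the induction
    carries along. *)
Lemma iter_commutator_exp n :
  iter n.+1 delta (L ^+ n) = 0 /\ iter n delta (L ^+ n) = X ^+ n *+ n`!.
Proof.
have d0 : delta 0 = 0 by rewrite /delta mulr0 mul0r subrr.
elim: n => [|n [IH1 IH2]].
  by rewrite /= /delta !expr0 mulr1 mul1r subrr.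
rewrite exprS !iter_commutatorM IH2; split.
  by rewrite iterS IH1 d0 !mulr0 mul0rn addr0.
by rewrite IH1 mulr0 add0r mulrnAr -mulrnA -exprS factS mulnC.
Qed.

End KleineckeShirokov.

(** The ring structure makes the Kleinecke-Shirokov identity, which lives in
    an arbitrary ring, available for bounded operators. *)
Section OperatorRing.
Context {R : realType} {H : normedModType R[i]}.
Implicit Types f g h : bop H H.

Lemma bop_compA f g h :
  bop_comp f (bop_comp g h) = bop_comp (bop_comp f g) h.
Proof. exact: bopE. Qed.

Lemma bop_comp1l f : bop_comp bop_id f = f.
Proof. exact: bopE. Qed.

Lemma bop_comp1r f : bop_comp f bop_id = f.
Proof. exact: bopE. Qed.

Lemma bop_compDl f g h : bop_comp (f + g) h = bop_comp f h + bop_comp g h.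
Proof. exact: bopE. Qed.

Lemma bop_compDr f g h : bop_comp f (g + h) = bop_comp f g + bop_comp f h.
Proof. by apply: bopE => x /=; rewrite linearD. Qed.

HB.instance Definition _ := GRing.Zmodule_isPzRing.Build (bop H H)
  bop_compA bop_comp1l bop_comp1r bop_compDl bop_compDr.

Lemma bop_mulE f g x : (f * g) x = f (g x).
Proof. by []. Qed.

Lemma bop_expE f n x : (f ^+ n) x = iter n f x.
Proof. by elim: n => // n IH; rewrite exprS bop_mulE IH. Qed.

Lemma bop_powE f n x : bop_pow f n x = iter n f x.
Proof. by elim: n => //= n ->. Qed.

Lemma bop_mulrnE f n x : (f *+ n) x = f x *+ n.
Proof. by elim: n => // n IH; rewrite !mulrS -IH. Qed.

Lemma opnorm_le_rnorm f (c : R) : 0 <= c ->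
  (forall x, rnorm (f x) <= c * rnorm x) -> opnorm f <= c.
Proof.
by move=> c0 fc; apply: opnorm_le => // x; rewrite !rnormE -rmorphM lecR.
Qed.

Lemma opnormM f g : opnorm (f * g) <= opnorm f * opnorm g.
Proof.
apply: opnorm_le_rnorm => [|x]; first by rewrite mulr_ge0 ?opnorm_ge0.
rewrite bop_mulE; apply: le_trans (bop_rnorm_bound _ _) _; rewrite -mulrA.
by rewrite ler_wpM2l ?opnorm_ge0 ?bop_rnorm_bound.
Qed.

Lemma opnormB f g : opnorm (f - g) <= opnorm f + opnorm g.
Proof.
apply: opnorm_le_rnorm => [|x]; first by rewrite addr_ge0 ?opnorm_ge0.
apply: le_trans (rnormB (f x) (g x)) _.
by rewrite mulrDl lerD ?bop_rnorm_bound.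
Qed.

Lemma opnormX f n : opnorm (f ^+ n) <= opnorm f ^+ n.
Proof.
elim: n => [|n IH].
  by apply: opnorm_le_rnorm => // x; rewrite expr0 mul1r.
rewrite !exprS; apply: le_trans (opnormM _ _) _.
by apply: ler_wpM2l IH; exact: opnorm_ge0.
Qed.

Lemma opnorm_iter_commutator (T Y : bop H H) n :
  opnorm (iter n (commutator_with T) Y) <= (2 * opnorm T) ^+ n * opnorm Y.
Proof.
elim: n => [|n IH]; first by rewrite expr0 mul1r.
rewrite iterS exprS; apply: le_trans (opnormB _ _) _.
apply: le_trans (lerD (opnormM _ _) (opnormM _ _)) _.
have := ler_wpM2l (opnorm_ge0 T) IH; lra.
Qed.

(** The Kleinecke-Shirokov identity, read with norms: n derivations of L^n
    cost a factor (2 |T|)^n. *)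
Lemma commutator_exp_bound (T L X : bop H H) n x :
  T * L - L * T = X -> T * X = X * T ->
  n`!%:R * rnorm ((X ^+ n) x) <= (2 * opnorm T * opnorm L) ^+ n * rnorm x.
Proof.
move=> TL TX; have [_ LX] := iter_commutator_exp TL TX n.
have -> : n`!%:R * rnorm ((X ^+ n) x) = rnorm ((X ^+ n *+ n`!) x).
  rewrite bop_mulrnE; have := rnormZr n`!%:R ((X ^+ n) x).
  by rewrite rmorph_nat scaler_nat normr_nat => ->.
rewrite -LX; apply: le_trans (bop_rnorm_bound _ _) _.
rewrite ler_wpM2r ?rnorm_ge0//.
apply: le_trans (opnorm_iter_commutator _ _ _) _.
by rewrite [leRHS]exprMn ler_wpM2l ?opnormX// exprn_ge0// mulr_ge0 ?opnorm_ge0.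
Qed.

End OperatorRing.

(** For self-adjoint X, the norms of the X^n x are log-convex because
    |X y|^2 is the inner product of y and X^2 y. *)
Lemma selfadjoint_commutator_eq0 (R : realType) (H : hilbertType R)
    (T L X : bop H H) : is_adjoint X X ->
  T * L - L * T = X -> T * X = X * T -> X = 0.
Proof.
move=> XX TL TX; apply: bopE => x; apply: rnorm0_eq0.
pose e n := rnorm (iter n X x).
apply: (@log_convex_factorial_decay _ e (2 * opnorm T * opnorm L)) => n.
- exact: rnorm_ge0.
- rewrite -rinner_sqr /= (is_adjoint_rinner _ _ XX) -iterS.
  exact: le_trans (ler_norm _) (rinner_le _ _).
- by rewrite /e -bop_expE; exact: commutator_exp_bound.
Qed.

(** * Polynomial boundedness of block operators over a normal operator *)

Section Adjoints.
Context {R : realType} {H : hilbertType R}.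
Implicit Types f g T S : bop H H.

Lemma is_adjointC T S : is_adjoint T S -> is_adjoint S T.
Proof.
by move=> TS x y; rewrite (hermC inner (S x)) (hermC inner x) /= TS.
Qed.

Lemma is_adjoint1 : is_adjoint (1 : bop H H) 1.
Proof. by []. Qed.

Lemma is_adjointM T S f g :
  is_adjoint T S -> is_adjoint f g -> is_adjoint (T * f) (g * S).
Proof. by move=> TS fg x y; rewrite !bop_mulE TS fg. Qed.

Lemma is_adjointB T S f g :
  is_adjoint T S -> is_adjoint f g -> is_adjoint (T - f) (S - g).
Proof.
move=> TS fg x y; rewrite -[(T - f) x]/(T x - f x) -[(S - g) y]/(S y - g y).
by rewrite linearBl linearBr /= TS fg.
Qed.

Lemma is_adjointX f n : is_adjoint f f -> is_adjoint (f ^+ n) (f ^+ n).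
Proof.
move=> ff; elim: n => [|n IH]; first exact: is_adjoint1.
by rewrite {1}exprS exprSr; exact: is_adjointM.
Qed.

End Adjoints.

Section PolynomialCalculus.
Context {R : realType}.

Definition power_bounded (H : normedModType R[i]) (T : bop H H) :=
  exists K : R, forall n x, rnorm ((T ^+ n) x) <= K * rnorm x.

Lemma bop_horner_rnorm (H : normedModType R[i]) (T : bop H H) :
  polynomially_bounded T -> exists2 C : R, 0 < C &
    forall p x, rnorm (bop_horner p T x) <= C * disc_sup p * rnorm x.
Proof.
move=> [C C0 TC]; exists C => // p x.
apply: le_trans (bop_rnorm_bound _ _) _.
by apply: ler_wpM2r (TC p); exact: rnorm_ge0.
Qed.

Lemma bop_hornerXn (H : normedModType R[i]) (T : bop H H) n :
  bop_horner 'X^n T = T ^+ n.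
Proof.
apply: bopE => x; rewrite bop_hornerE size_polyXn big_ord_recr /=.
rewrite big1 ?add0r => [|i _].
  by rewrite coefXn eqxx scale1r bop_powE bop_expE.
by rewrite coefXn ltn_eqF ?scale0r.
Qed.

Lemma polynomially_bounded_power (H : normedModType R[i]) (T : bop H H) :
  polynomially_bounded T -> power_bounded T.
Proof.
move=> /bop_horner_rnorm[C C0 TC]; exists C => n x.
rewrite -bop_hornerXn; apply: le_trans (TC _ _) _.
rewrite ler_wpM2r ?rnorm_ge0//.
by rewrite -[leRHS]mulr1 ler_wpM2l ?disc_sup_Xn_le1// ltW.
Qed.

Context {H : hilbertType R}.

(** For n = 0 the truncated exponent n.-1 is harmless, as the term is then
    multiplied by 0. *)
Lemma block_pow_commute (T X : bop H H) : T * X = X * T ->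
  forall n (u : hsum H H), bop_pow (block_op T X T) n u =
    ((T ^+ n) u.1 + ((T ^+ n.-1 * X) *+ n) u.2, (T ^+ n) u.2).
Proof.
move=> TX n u; elim: n => [|n IH].
  by rewrite !expr0 mulr0n /= addr0; case: u.
rewrite bop_powS IH /= linearD /=; congr pair; last by rewrite exprS.
rewrite -addrA exprS; congr (_ + _).
rewrite -[LHS]/((T * ((T ^+ n.-1 * X) *+ n) + X * T ^+ n) u.2).
congr (bop_fun _ _).
have -> : X * T ^+ n = T ^+ n * X.
  by apply: commrX.
case: n {IH} => [|n]; first by rewrite mulr0n mulr0 add0r mulr1n.
by rewrite /= mulrnAr mulrA -exprS [RHS]mulrSr.
Qed.

(** The corner p'(T) X of the block is summed term by term: the n-th term is
    at most |p_n| n K / n^3, and 1 / n^2 is summable. *)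
Lemma block_polynomially_bounded (T X : bop H H) (K : R) : 0 <= K ->
  polynomially_bounded T -> T * X = X * T ->
  (forall n x, n.+1%:R ^+ 3 * rnorm ((T ^+ n * X) x) <= K * rnorm x) ->
  polynomially_bounded (block_op T X T).
Proof.
move=> K0 /bop_horner_rnorm[C C0 TC] TX XK.
exists (2 * C + 6 * K) => [|p]; first by lra.
apply: opnorm_le => [|u].
  by rewrite mulr_ge0 ?disc_sup_ge0// addr_ge0// mulr_ge0// ltW.
have M0 := disc_sup_ge0 p; set M := disc_sup p in M0 *.
pose w := \sum_(i < size p) p`_i *: ((T ^+ i.-1 * X) *+ i) u.2.
have -> : bop_horner p (block_op T X T) u =
    ((bop_horner p T u.1 + w, bop_horner p T u.2) : hsum H H).
  rewrite !bop_hornerE /w -big_split /=.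
  elim/big_ind3 : _ => // [a b c d e f -> ->//|i _].
  rewrite block_pow_commute// -scalerDr !bop_powE -!bop_expE.
  by [].
apply: le_trans (hsum_norm_leD _) _ => /=.
have u1 : rnorm u.1 <= rnorm u by rewrite -lecR -!rnormE hsum_norm_le1.
have u2 : rnorm u.2 <= rnorm u by rewrite -lecR -!rnormE hsum_norm_le2.
(* The bound is stated with the next two indices rather than n + 1 and n + 2,
   so that [term] has a telescoping right-hand side that also covers n = 0. *)
have inv_sq n : (n.+1%:R ^+ 2)^-1 <= 6 * (n.+2%:R^-1 - n.+3%:R^-1) :> R.
  rewrite -[n.+3%:R]natr1 -[n.+2%:R]natr1 -[n.+1%:R]natr1.
  have := ler0n R n; set x := n%:R => x0; rewrite -subr_ge0.
  have -> : 6 * ((x + 1 + 1)^-1 - (x + 1 + 1 + 1)^-1) - ((x + 1) ^+ 2)^-1 =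
     (5 * x ^+ 2 + 7 * x) / ((x + 1) ^+ 2 * (x + 2) * (x + 3)).
    by field; rewrite !gt_eqF//; lra.
  by apply: divr_ge0; rewrite ?mulr_ge0 ?addr_ge0 ?mulr_ge0 ?sqr_ge0//; lra.
have term n : rnorm (((T ^+ n.-1 * X) *+ n) u.2) <=
    6 * K * rnorm u.2 * (n.+1%:R^-1 - n.+2%:R^-1).
  case: n => [|n] /=.
    rewrite [X in rnorm X](_ : _ = 0)// rnorm0 mulr_ge0 ?mulr_ge0 ?rnorm_ge0//.
    by rewrite subr_ge0 lef_pV2 ?posrE// ler_nat.
  have n2 : 0 < n.+1%:R ^+ 2 :> R by rewrite exprn_gt0.
  rewrite bop_mulrnE.
  have -> : rnorm ((T ^+ n * X) u.2 *+ n.+1) = n.+1%:R * rnorm ((T ^+ n * X) u.2).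
    have := rnormZr n.+1%:R ((T ^+ n * X) u.2).
    by rewrite rmorph_nat scaler_nat normr_nat.
  apply: (@le_trans _ _ (K * rnorm u.2 * (n.+1%:R ^+ 2)^-1)).
    by rewrite ler_pdivlMr//; apply: le_trans (XK n u.2); rewrite mulrAC -exprS.
  have := ler_wpM2l (mulr_ge0 K0 (rnorm_ge0 u.2)) (inv_sq n).
  by rewrite !mulrA [_ * 6]mulrC !mulrA.
have wle : rnorm w <= 6 * K * M * rnorm u.2.
  have K6 : 0 <= 6 * K * M * rnorm u.2 by rewrite !mulr_ge0 ?rnorm_ge0.
  apply: (@le_trans _ _
     (6 * K * M * rnorm u.2 * (1 - (size p).+1%:R^-1))); last first.
    by rewrite ler_piMr// gerBl invr_ge0.
  rewrite /w; apply: le_trans (rnorm_sum _ _ _) _.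
  elim: (size p) => [|k IH]; first by rewrite big_ord0 invr1 subrr mulr0.
  rewrite big_ord_recr /=; apply: le_trans (lerD IH _) _.
    rewrite rnormZ; apply: (@le_trans _ _ (M * (6 * K * rnorm u.2 *
        (k.+1%:R^-1 - k.+2%:R^-1)))); last exact: lexx.
    apply: ler_pM (term k) => //; [|exact: rnorm_ge0|exact: coef_le_disc_sup].
    by rewrite -lecR -normc_ReE; exact: normr_ge0.
  by rewrite le_eqVlt; apply/orP; left; apply/eqP; ring.
rewrite !rnormE -rmorphD -rmorphM lecR.
have h1 := rnormD (bop_horner p T u.1) w.
have h2 := TC p u.1; have h3 := TC p u.2; rewrite -/M in h2 h3.
have CM : 0 <= C * M by rewrite mulr_ge0// ltW.
have KM : 0 <= 6 * K * M by rewrite !mulr_ge0.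
have := ler_wpM2l CM u1; have := ler_wpM2l CM u2; have := ler_wpM2l KM u2.
lra.
Qed.

End PolynomialCalculus.

Section Defect.
Context {R : realType} {H : hilbertType R}.
Variables T S : bop H H.
Hypotheses (TS : is_adjoint T S) (nT : T * S = S * T).

(** For normal T, the defect vanishes exactly when T is unitary. *)
Definition defect : bop H H := 1 - S * T.
Local Notation D := defect.

Lemma defect_selfadjoint : is_adjoint D D.
Proof.
apply: is_adjointB; first exact: is_adjoint1.
by apply: is_adjointM => //; exact: is_adjointC.
Qed.

Lemma defect_commute : T * D = D * T.
Proof. by rewrite /D mulrBr mulrBl mulr1 mul1r mulrA nT. Qed.

Lemma normal_adjoint_rnorm x : rnorm (S x) = rnorm (T x).
Proof.
apply/eqP; rewrite -(@eqrXn2 _ 2) ?rnorm_ge0// -!rinner_sqr.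
rewrite (is_adjoint_rinner _ _ TS) (is_adjoint_rinner _ _ (is_adjointC TS)).
by rewrite -!bop_mulE nT.
Qed.

Lemma defect_rnorm x : rnorm (D x) ^+ 2 =
  rnorm x ^+ 2 - 2 * rnorm (T x) ^+ 2 + rnorm (T (T x)) ^+ 2.
Proof.
rewrite -[D x]/(x - S (T x)) rnormB_sqr normal_adjoint_rnorm.
by rewrite -(is_adjoint_rinner _ _ TS) rinner_sqr.
Qed.

Lemma defect_powE n x : (T ^+ n * D) x = D ((T ^+ n) x).
Proof.
rewrite -bop_mulE; congr (bop_fun _ _).
by rewrite (commrX n (esym defect_commute)).
Qed.

Let a x n := rnorm ((T ^+ n) x) ^+ 2.

Let second_difference x n :
  a x n - 2 * a x n.+1 + a x n.+2 = rnorm ((T ^+ n * D) x) ^+ 2.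
Proof. by rewrite defect_powE defect_rnorm /a !exprS. Qed.

Hypothesis pbT : power_bounded T.

Lemma normal_power_bounded_contraction x : rnorm (T x) <= rnorm x.
Proof.
have [K TK] := pbT.
rewrite -(@ler_pXn2r _ 2) ?nnegrE ?rnorm_ge0//.
apply: (@convex_bounded_nonincreasing _ (a x) ((K * rnorm x) ^+ 2) _ _ 0%N).
- by move=> n; rewrite second_difference sqr_ge0.
- move=> n; have := TK n x; have := rnorm_ge0 ((T ^+ n) x) => h0 h.
  by rewrite /a ler_pXn2r ?nnegrE// (le_trans h0).
Qed.

(** The squared norm of T^n D x is the second difference of |T^n x|^2, and it
    does not increase with n because T is a contraction. *)
Lemma defect_decay n x : n.+1%:R * rnorm ((T ^+ n * D) x) <= 2 * rnorm x.
Proof.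
have contr y m : a y m.+1 <= a y m.
  rewrite /a [T ^+ m.+1]exprS ler_pXn2r ?nnegrE ?rnorm_ge0//.
  exact: normal_power_bounded_contraction.
have h : n.+1%:R ^+ 2 * rnorm ((T ^+ n * D) x) ^+ 2 <= 2 * rnorm x ^+ 2.
  rewrite -second_difference.
  apply: (@convex_second_difference_decay _ (a x)) => m; first exact: sqr_ge0.
    exact: contr.
  by rewrite !second_difference; exact: contr.
rewrite -(@ler_pXn2r _ 2) ?nnegrE ?mulr_ge0 ?rnorm_ge0//.
rewrite !exprMn; apply: le_trans h _.
by rewrite ler_wpM2r ?sqr_ge0// -natrX ler_nat.
Qed.

(** Spending about n/3 powers of T on each factor D gains three factors 1/n. The
    power D^2 would not do for [block_polynomially_bounded]: it only gains
    1/n^2, and the sum of the n / n^2 diverges. *)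
Lemma defect_cube_decay n x :
  n.+1%:R ^+ 3 * rnorm ((T ^+ n * D ^+ 3) x) <= 216 * rnorm x.
Proof.
pose q := (n %/ 3)%N; pose r := (n %% 3)%N.
have E : T ^+ n * D ^+ 3 = T ^+ r * (T ^+ q * D) ^+ 3.
  have c : GRing.comm (T ^+ q) D.
    by apply/commr_sym/commrX/commr_sym; exact: defect_commute.
  rewrite exprMn_comm// -exprM mulrA -exprD.
  by congr (_ ^+ _ * _); rewrite /q /r; lia.
have contr m y : rnorm ((T ^+ m) y) <= rnorm y.
  elim: m => [|m IH]; first by rewrite expr0.
  rewrite exprS; apply: le_trans IH.
  exact: normal_power_bounded_contraction.
rewrite E; set F := T ^+ q * D; rewrite !exprS expr0 mulr1 !bop_mulE.
have h0 := defect_decay q x.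
have h1 := defect_decay q (F x); have h2 := defect_decay q (F (F x)).
rewrite -/F in h0 h1 h2.
have q0 : 0 < q.+1%:R :> R by [].
have h3 := contr r (F (F (F x))).
have nq : n.+1%:R <= 3 * q.+1%:R :> R by rewrite -natrM ler_nat /q; lia.
have n0 : 0 <= n.+1%:R :> R by [].
have nq3 : n.+1%:R ^+ 3 <= 27 * q.+1%:R ^+ 3 :> R.
  have -> : 27 * q.+1%:R ^+ 3 = (3 * q.+1%:R) ^+ 3 :> R by ring.
  by rewrite ler_pXn2r ?nnegrE// mulr_ge0.
apply: le_trans (ler_pM _ _ nq3 h3) _; rewrite ?exprn_ge0 ?rnorm_ge0//.
have g1 := ler_wpM2l (ltW q0) h1.
have g2 := ler_wpM2l (exprn_ge0 2 (ltW q0)) h2.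
lra.
Qed.

Lemma defect_cube_eq0 : D ^+ 3 = 0 -> D = 0.
Proof.
move=> D3; apply: bopE => x; apply: rnorm0_eq0.
have sq y : rnorm (D y) ^+ 2 = rinner y (D (D y)).
  by rewrite -rinner_sqr (is_adjoint_rinner _ _ defect_selfadjoint).
have D2 y : D (D y) = 0.
  apply: rnorm0_eq0; apply/eqP; rewrite -sqrf_eq0 sq.
  rewrite -[D (D (D y))]/((D * (D * D)) y).
  have -> : D * (D * D) = 0 by rewrite -D3 !exprS expr0 mulr1.
  by rewrite -[(0 : bop H H) y]/(0 : H) -(subrr (0 : H)) rinnerDr rinnerNr subrr.
apply/eqP; rewrite -sqrf_eq0 sq D2.
by rewrite -(subrr (0 : H)) rinnerDr rinnerNr subrr.
Qed.

End Defect.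

(** * Weak limits of bounded sequences of operators *)

Section Riesz.
Context {R : realType} {H : hilbertType R}.

(** The representing vector minimises |y|^2 - 2 phi y. By the parallelogram
    law, nearly minimising vectors are close to each other, so completeness
    provides a minimiser. *)
Lemma riesz_real (phi : H -> R) (K : R) :
  (forall x y, phi (x + y) = phi x + phi y) ->
  (forall (t : R) x, phi (t%:C%C *: x) = t * phi x) ->
  (forall x, `|phi x| <= K * rnorm x) ->
  exists z, forall y, phi y = rinner z y.
Proof.
move=> phiD phiZ phiK.
pose J y := rnorm y ^+ 2 - 2 * phi y.
have JK y : - K ^+ 2 <= J y.
  have := phiK y; have := ler_norm (phi y); have := sqr_ge0 (rnorm y - K).
  by rewrite /J; nra.
have Jinf : has_inf (range J).
  by split; [exists (J 0), 0 | exists (- K ^+ 2) => _ [y _ <-]].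
set m := inf (range J).
have mJ y : m <= J y by apply: (inf_lbound (proj2 Jinf)); exists y.
have Jm (e : R) : 0 < e -> exists y, J y < m + e.
  by move=> e0; have [_ [y _ <-] ?] := inf_adherent e0 Jinf; exists y.
(* The linear terms of J cancel in the parallelogram law for x, y, (x + y)/2. *)
have para x y : rnorm (x - y) ^+ 2 <= 2 * (J x - m) + 2 * (J y - m).
  have := mJ ((2^-1 : R)%:C%C *: (x + y)).
  rewrite {1}/J rnormZr phiZ phiD exprMn rnormD_sqr rnormB_sqr.
  rewrite ger0_norm// /J; lra.
pose r (n : nat) : R := n.+1%:R^-1.
have r0 n : 0 < r n by rewrite invr_gt0.
have /choice[u uP] n : exists y, J y < m + r n ^+ 2.
  by apply: Jm; rewrite exprn_gt0.
have u_close n k : (n <= k)%N -> rnorm (u n - u k) <= 2 * r n.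
  move=> nk; rewrite -(@ler_pXn2r _ 2) ?nnegrE ?rnorm_ge0 ?mulr_ge0 ?(ltW (r0 _))//.
  have rk : r k <= r n by rewrite /r lef_pV2 ?posrE// ler_nat.
  have rk2 : r k ^+ 2 <= r n ^+ 2 by rewrite ler_pXn2r ?nnegrE ?(ltW (r0 _)).
  have := para (u n) (u k); have := uP n; have := uP k; lra.
have small (e : R) : 0 < e -> exists N, 2 * r N < e.
  move=> e0; exists (Num.bound (2 / e)); rewrite /r ltr_pdivrMr// mulrC.
  rewrite -ltr_pdivrMr//; apply: lt_trans (archi_boundP _) _; first by rewrite divr_ge0// ltW.
  by rewrite ltr_nat.
have /cvg_ex[z uz] : cvg (u @ \oo).
  apply: cauchy_cvg; apply: cauchy_exP => e e0.
  have eE : e = (complex.Re e)%:C%C by rewrite RRe_real// gtr0_real.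
  have e'0 : 0 < complex.Re e by rewrite -ltcR -eE.
  have [N Ne] := small _ e'0; exists (u N).
  have : \forall n \near \oo, ball (u N) e (u n); last by [].
  near=> n; rewrite -ball_normE /= rnormE eE ltcR; apply: le_lt_trans Ne.
  by apply: u_close; near: n; exact: nbhs_infty_ge.
have z_close N : exists2 n, (N <= n)%N & rnorm (z - u n) <= r N.
  have rN0 : 0 < (r N)%:C%C by rewrite ltcR.
  have zu : \forall n \near \oo, `|z - u n| <= (r N)%:C%C.
    exact: (@cvgr_dist_le _ _ _ _ _ _ _ uz _ rN0).
  have [n [Nn zn]] : exists n, (N <= n)%N /\ `|z - u n| <= (r N)%:C%C.
    apply: (@filter_ex _ \oo); near=> n; split; near: n => //.
    exact: nbhs_infty_ge.
  by exists n => //; rewrite -lecR -rnormE.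
exists z => y.
have dist N : `|phi y - rinner z y| <= 2 * r N * rnorm y.
  have [n Nn zn] := z_close N.
  have rn : r n <= r N by rewrite /r lef_pV2 ?posrE// ler_nat.
  have h1 := rinner_le (z - u n) y.
  rewrite rinnerDl rinnerNl in h1.
  have h2 : `|phi y - rinner (u n) y| <= r N * rnorm y.
    pose d := phi y - rinner (u n) y.
    (* u n + t y cannot lie below the infimum, for any t. *)
    have quad (t : R) : 0 <= t ^+ 2 * rnorm y ^+ 2 - 2 * t * d + r n ^+ 2.
      have := mJ (u n + t%:C%C *: y); have := uP n.
      rewrite /J rnormD_sqr rinnerZr rnormZr phiD phiZ exprMn real_normK ?num_real//.
      rewrite /d; lra.
    have yn : 0 <= rnorm y by exact: rnorm_ge0.
    apply: (@le_trans _ _ (r n * rnorm y)); last exact: ler_wpM2r.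
    have [y0|y0] := eqVneq (rnorm y) 0.
      have := phiK y; have := rinner_le (u n) y; rewrite y0 !mulr0 !normr_le0.
      by move=> /eqP-> /eqP->; rewrite subrr.
    rewrite -(@ler_pXn2r _ 2) ?nnegrE ?mulr_ge0 ?(ltW (r0 _))//.
    rewrite real_normK ?num_real// -/d -subr_ge0.
    have := mulr_ge0 (quad (d / rnorm y ^+ 2)) (sqr_ge0 (rnorm y)).
    move=> h; apply: le_trans h _; rewrite le_eqVlt; apply/orP; left.
    by apply/eqP; field.
  have h3 : rnorm (z - u n) * rnorm y <= r N * rnorm y.
    by rewrite ler_wpM2r ?rnorm_ge0.
  have := le_trans h1 h3; move: h2; rewrite !ler_norml => /andP[? ?] /andP[? ?].
  by apply/andP; split; lra.
apply/eqP; rewrite -subr_eq0 -normr_le0; apply/ler_addgt0Pr => e e0; rewrite add0r.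
have y1 : 0 < rnorm y + 1 by rewrite ltr_wpDl// rnorm_ge0.
have [N Ne] := small (e / (rnorm y + 1)) (divr_gt0 e0 y1).
apply: le_trans (dist N) _; move: Ne; rewrite ltr_pdivlMr// => Ne.
have := r0 N; have := rnorm_ge0 y; nra.
Unshelve. all: by end_near. Qed.

End Riesz.

Section WeakLimits.
Context {R : realType}.

(** Compactness of the segment gives a cluster point, which is a limit because
    an ultrafilter contains every set that meets all its members. *)
Lemma ultra_bounded_cvg (G : set_system nat) (f : nat -> R) (K : R) :
  UltraFilter G -> (forall n, `|f n| <= K) -> cvg (f @ G).
Proof.
move=> GU fK; have [p [_ pG]] : `[- K, K]%classic `&` cluster (f @ G) !=set0.
  apply: segment_compact; apply: (@filterS _ G _ setT) filterT => n _ /=.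
  by rewrite in_itv /= -ler_norml.
apply/cvg_ex; exists p => U pU.
have [//|GnU] := in_ultra_setVsetC (f @^-1` U) GU.
have [x [/= nUx Ux]] := pG (~` U) U GnU pU.
by [].
Qed.

Context {H : hilbertType R}.

Lemma weak_ultralimit (G : set_system nat) (v : nat -> H) (K : R) :
  UltraFilter G -> (forall n, rnorm (v n) <= K) ->
  exists z, forall y, rinner (v n) y @[n --> G] --> rinner z y.
Proof.
move=> GU vK; pose phi y := lim (rinner (v n) y @[n --> G]).
have bnd y n : `|rinner (v n) y| <= K * rnorm y.
  by apply: le_trans (rinner_le _ _) _; rewrite ler_wpM2r ?rnorm_ge0.
have phiP y : rinner (v n) y @[n --> G] --> phi y.
  exact: (ultra_bounded_cvg GU (bnd y)).
have [| | |z zP] := @riesz_real _ _ phi K.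
- move=> x y; apply: cvg_lim => //.
  under eq_fun do rewrite rinnerDr.
  by apply: cvgD; exact: phiP.
- move=> t x; apply: cvg_lim => //.
  under eq_fun do rewrite rinnerZr.
  by apply: cvgMr; exact: phiP.
- move=> y; have K0 := bnd y; rewrite ler_norml; apply/andP; split.
    apply: (cvgr_to_ge (phiP y)); near=> n.
    by have := bnd y n; rewrite ler_norml => /andP[].
  apply: (cvgr_to_le (phiP y)); near=> n.
  by have := bnd y n; rewrite ler_norml => /andP[].
by exists z => y; rewrite -zP.
Unshelve. all: by end_near. Qed.

(** Only real parts of inner products are taken to the limit; complex
    linearity survives since a scalar moves to the other argument. *)
Lemma weak_operator_ultralimit (G : set_system nat) (A : nat -> bop H H) (K : R) :
  UltraFilter G -> (forall n x, rnorm (A n x) <= K * rnorm x) ->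
  exists L : bop H H,
    forall x y, rinner (A n x) y @[n --> G] --> rinner (L x) y.
Proof.
move=> GU AK.
have /choice[L LP] x : exists z, forall y,
    rinner (A n x) y @[n --> G] --> rinner z y.
  exact: (weak_ultralimit GU (AK^~ x)).
have Llin : linear L.
  move=> a x x'; apply: rinner_inj => y; rewrite rinnerDl rinnerZl.
  have lim2 : rinner (A n (a *: x + x')) y @[n --> G] -->
      rinner (L x) (conjc a *: y) + rinner (L x') y.
    under eq_fun do rewrite bop_linear rinnerDl rinnerZl.
    by apply: cvgD; exact: LP.
  exact: cvg_unique (LP _ y) lim2.
have LK x : rnorm (L x) <= K * rnorm x.
  have [->|Lx] := eqVneq (rnorm (L x)) 0.
    by apply: le_trans (rnorm_ge0 _) (AK 0%N x).
  rewrite -(@ler_pM2r _ (rnorm (L x))); last by rewrite lt_def Lx rnorm_ge0.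
  rewrite -expr2 -rinner_sqr; apply: (cvgr_to_le (LP x (L x))).
  near=> n; apply: le_trans (ler_norm _) _; apply: le_trans (rinner_le _ _) _.
  by rewrite ler_wpM2r ?rnorm_ge0.
have Lb : L \in @bounded_operator R H H.
  apply/asboolP; split=> //.
  pose g : {linear H -> H} := HB.pack L (GRing.isLinear.Build R[i] H H _ L Llin).
  apply: (proj1 (@linear_bounded_continuous _ _ _ g)); apply/linear_boundedP.
  near=> k => x; apply: (@le_trans _ _ ((`|K| + 1)%:C%C * `|x|)).
    rewrite !rnormE -rmorphM lecR; apply: le_trans (LK x) _.
    by rewrite ler_wpM2r ?rnorm_ge0// ler_wpDr// ler_norm.
  rewrite ler_wpM2r//; near: k; apply: nbhs_pinfty_ge.
  by rewrite complex_real.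
by exists (Bop Lb).
Unshelve. all: by end_near. Qed.

End WeakLimits.

(** * Extensions of a unitary operator by itself *)

Section UnitaryCocycle.
Context {R : realType} {H : hilbertType R}.
Variables T S X : bop H H.
Hypotheses (TS : is_adjoint T S) (ST1 : S * T = 1) (TS1 : T * S = 1).
Hypothesis pbX : polynomially_bounded (block_op T X T).

Local Notation blk := (block_op T X T).

(** The upper right corner of the n-th power of the block operator, rotated
    back by T^-n = S^n. *)
Definition rotated_corner n : bop H H :=
  bop_comp (S ^+ n) (bop_comp (Bop (@hsum_fst_subproof R H H))
    (bop_comp (bop_pow blk n) (Bop (@hsum_inr_subproof R H H)))).
Local Notation Y := rotated_corner.

Lemma rotated_cornerE n x : Y n x = (S ^+ n) (bop_pow blk n (0, x)).1.
Proof. by []. Qed.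

Lemma rotated_corner0 x : Y 0 x = 0.
Proof. by []. Qed.

Lemma bop_powSr (V : normedModType R[i]) (F : bop V V) n x :
  bop_pow F n.+1 x = bop_pow F n (F x).
Proof. by rewrite !bop_powE iterSr. Qed.

Lemma block_pow_inl n x : bop_pow blk n (x, 0) = ((T ^+ n) x, 0).
Proof.
elim: n => [//|n IH]; rewrite bop_powS IH /= !linear0 addr0.
by rewrite exprS.
Qed.

(** This recurrence, which comes from splitting off the first application of
    the block operator, turns a shift-invariant limit L of the Y n into a
    solution of T L = X + L T. *)
Lemma rotated_cornerS n x : T (Y n.+1 x) = X x + Y n (T x).
Proof.
have SnTn m : S ^+ m * T ^+ m = 1.
  elim: m => [|m IH]; first by rewrite !expr0 mulr1.
  by rewrite exprSr exprS mulrA -[_ * S * T]mulrA ST1 mulr1.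
rewrite !rotated_cornerE bop_powSr -bop_mulE exprS mulrA TS1 mul1r.
have -> : blk (0, x) = ((X x, 0) : hsum H H) + (0, T x).
  by congr pair; rewrite /= ?linear0 ?add0r ?addr0.
rewrite linearD /= block_pow_inl /= linearD; congr (_ + _).
by rewrite -[LHS]/((S ^+ n * T ^+ n) (X x)) SnTn.
Qed.

Lemma unitary_adjoint_rnorm x : rnorm (S x) = rnorm x.
Proof.
apply/eqP; rewrite -(@eqrXn2 _ 2) ?rnorm_ge0// -!rinner_sqr.
by rewrite (is_adjoint_rinner _ _ (is_adjointC TS)) -bop_mulE TS1.
Qed.

Lemma rotated_corner_bounded :
  exists K : R, 0 <= K /\ forall n x, rnorm (Y n x) <= K * rnorm x.
Proof.
have [K BK] := polynomially_bounded_power pbX.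
exists `|K|; split=> // n x; rewrite rotated_cornerE.
have Sn m y : rnorm ((S ^+ m) y) = rnorm y.
  by elim: m => // m IH; rewrite exprS bop_mulE unitary_adjoint_rnorm.
rewrite Sn bop_powE -bop_expE; set w := (blk ^+ n) _.
have w1 : rnorm w.1 <= rnorm w by rewrite -lecR -!rnormE; exact: hsum_norm_le1.
apply: le_trans w1 _; apply: le_trans (BK n _) _.
have x1 : rnorm ((0, x) : hsum H H) <= rnorm x.
  rewrite -lecR -!rnormE; apply: le_trans (hsum_norm_leD _) _.
  by rewrite /= normr0 add0r.
apply: (@le_trans _ _ (`|K| * rnorm ((0, x) : hsum H H))).
  by rewrite ler_wpM2r ?rnorm_ge0 ?ler_norm.
exact: ler_wpM2l.
Qed.

Definition cesaro_mean n : bop H H :=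
  (n.+1%:R^-1 : R)%:C%C *: \sum_(k < n.+1) Y k.

Lemma bop_sumE n (F : nat -> bop H H) x :
  (\sum_(k < n) F k) x = \sum_(k < n) F k x.
Proof. by elim/big_rec2 : _ => // i a b _ <-. Qed.

Lemma cesaro_mean_bounded (K : R) :
  (forall n x, rnorm (Y n x) <= K * rnorm x) ->
  forall n x, rnorm (cesaro_mean n x) <= K * rnorm x.
Proof.
move=> YK n x.
rewrite -[cesaro_mean n x]/((n.+1%:R^-1)%:C%C *: (\sum_(k < n.+1) Y k) x).
rewrite bop_sumE rnormZr ger0_norm ?invr_ge0//.
rewrite ler_pdivrMl//; apply: le_trans (rnorm_sum _ _ _) _.
apply: (@le_trans _ _ (\sum_(k < n.+1) K * rnorm x)); first by apply: ler_sum.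
by rewrite sumr_const card_ord mulr_natl.
Qed.

(** The sum of the T Y_k - Y_k T telescopes, so the means solve the equation
    up to 1 / (n + 1) times a bounded term. *)
Lemma cesaro_mean_cocycle n x :
  T (cesaro_mean n x) - cesaro_mean n (T x) - X x =
  - ((n.+1%:R^-1)%:C%C *: T (Y n.+1 x)).
Proof.
have cE y : cesaro_mean n y = (n.+1%:R^-1)%:C%C *: \sum_(k < n.+1) Y k y.
  by rewrite -bop_sumE.
rewrite !cE linearZ -scalerBr linear_sum -sumrB /=.
have -> : \sum_(k < n.+1) (T (Y k x) - Y k (T x)) =
    (X x) *+ n.+1 - T (Y n.+1 x).
  elim: n {cE} => [|n IH].
    rewrite big_ord1 rotated_cornerS [LHS](_ : _ = T 0 - 0)// linear0.
    by rewrite rotated_corner0 addr0 !subrr.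
  rewrite big_ord_recr /= IH [T (Y n.+2 x)]rotated_cornerS [X x *+ n.+2]mulrSr.
  by rewrite addrA subrK opprD [RHS]addrA addrK.
rewrite scalerBr -(@scaler_nat R[i] H) scalerA.
rewrite -(rmorph_nat (real_complex R)) -rmorphM.
by rewrite mulVf ?pnatr_eq0// scale1r addrAC subrr add0r.
Qed.

Lemma unitary_cocycle_trivial : exists L : bop H H, X = T * L - L * T.
Proof.
have [K [K0 YK]] := rotated_corner_bounded.
have [G [GU Goo]] := @ultraFilterLemma nat \oo _.
have [L LP] := weak_operator_ultralimit GU (cesaro_mean_bounded YK).
exists L; apply: bopE => x; apply: rinner_inj => y.
have lim : rinner (T (cesaro_mean n x) - cesaro_mean n (T x) - X x) y @[n --> G] -->
    rinner (T (L x) - L (T x) - X x) y.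
  rewrite !(rinnerDl, rinnerNl) (is_adjoint_rinner _ _ TS).
  under eq_fun do rewrite !(rinnerDl, rinnerNl) (is_adjoint_rinner _ _ TS).
  apply: cvgB; last exact: cvg_cst.
  by apply: cvgB; exact: LP.
have lim0 : rinner (T (cesaro_mean n x) - cesaro_mean n (T x) - X x) y @[n --> G] --> 0.
  under eq_fun do rewrite cesaro_mean_cocycle rinnerNl.
  pose B := K * rnorm x * rnorm y.
  have B_cvg : B * harmonic n @[n --> \oo] --> (0 : R).
    by rewrite -(mulr0 B); apply: cvgMr; exact: cvg_harmonic.
  have bnd n : `|- rinner ((n.+1%:R^-1)%:C%C *: T (Y n.+1 x)) y| <= B * harmonic n.
    rewrite normrN rinnerC rinnerZr rinnerC (is_adjoint_rinner _ _ TS) normrM.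
    rewrite ger0_norm ?invr_ge0// mulrC ler_wpM2r ?invr_ge0//.
    apply: le_trans (rinner_le _ _) _; rewrite unitary_adjoint_rnorm.
    by rewrite ler_wpM2r ?rnorm_ge0.
  apply: cvg_trans (cvg_app _ Goo) _.
  apply: (@squeeze_cvgr _ _ _ _ (fun n => - (B * harmonic n))
    (fun n => B * harmonic n)) => //; last by rewrite -oppr0; exact: cvgN.
  by near=> n; rewrite -ler_norml.
have e0 : rinner (T (L x) - L (T x) - X x) y = 0 by exact: cvg_unique lim lim0.
apply/esym/eqP; rewrite -subr_eq0 -e0 -rinnerNl -rinnerDl.
by [].
Unshelve. all: by end_near. Qed.

End UnitaryCocycle.

(** * Triviality of the self-extensions *)

Theorem theorem3p3 (R : realType) (M : hilbertModule R) :
  normal_bop (hm_op M) ->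
  (unitary_bop (hm_op M) <-> (forall x : Ext1 M M, x = 0)).
Proof.
case=> S TS nT; split=> [[S' TS' [ST1 TS1]] | /Ext1_trivialP E0].
  apply/Ext1_trivialP => X pbX.
  exact: unitary_cocycle_trivial TS' ST1 TS1 pbX.
set T := hm_op M in TS nT E0 *.
have pbT : polynomially_bounded T := @hm_bounded _ M.
pose D := defect T S.
have TD : T * D ^+ 3 = D ^+ 3 * T by apply: commrX; exact: defect_commute.
have pbX : polynomially_bounded (block_op T (D ^+ 3) T).
  apply: (@block_polynomially_bounded _ _ _ _ 216) => // n x.
  exact: defect_cube_decay TS nT (polynomially_bounded_power pbT) n x.
have [L LD] := E0 _ pbX.
have D3 : D ^+ 3 = 0.
  apply: (selfadjoint_commutator_eq0 _ (esym LD) TD).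
  by apply: is_adjointX; exact: defect_selfadjoint.
have D0 : D = 0 := defect_cube_eq0 TS D3.
have ST1 : S * T = 1 by apply/esym/eqP; rewrite -subr_eq0; apply/eqP.
by exists S => //; split=> //; rewrite nT.
Qed.
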